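(* Let $L\ge2$ and $N\ge0$ be integers and assume that the random vector $X=(X_1,\dots,X_L)$ follows the Maxwell-Boltzmann statistics with $L$ sites and $N$ particles. Denote by $\gamma_L^N\in\mathcal{P}(\mathbb{Z}_+^2)$ the distribution of $(X_1,X_2)$ and let $\lambda^{N/L}\in\mathcal{P}(\mathbb{Z}_+)$ be the Poisson distribution with parameter $N/L$. Then $$\Vert\gamma_L^N-\lambda^{N/L}\otimes\lambda^{N/L}\Vert\le\frac{4N}{L^2}.$$
   Context: $\mathbb{Z}_+$ is the set of non-negative integers. $\mathcal{P}(S)$ is the set of probability measures on a denumerable set $S$, endowed with the total variation distance $\Vert p-q\Vert:=\sup_{A\subseteq S}(p(A)-q(A))=\frac12\sum_{s\in S}|p(\{s\})-q(\{s\})|$. $X=(X_1,\dots,X_L)$ follows the Maxwell-Boltzmann statistics with $L$ sites and $N$ particles if $\mathbb{P}(X_1=x_1,\dots,X_L=x_L)=\binom{N}{x_1,\dots,x_L}\frac{1}{L^N}$ when $(x_1,\dots,x_L)\in\mathbb{Z}_+^L$ and $\sum_{k=1}^L x_k=N$, and $0$ otherwise, where $\binom{N}{x_1,\dots,x_L}$ is the multinomial coefficient. *)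

(* Defs.v *)
From HB Require Import structures.
From mathcomp Require Import all_boot all_order all_algebra.
From mathcomp Require Import all_classical all_reals all_analysis.

Set Implicit Arguments.
Unset Strict Implicit.
Unset Printing Implicit Defensive.

Import Order.TTheory GRing.Theory Num.Theory.
Local Open Scope classical_set_scope.
Local Open Scope ring_scope.

(* The supremum runs over all subsets of S, so this is meant for countable S in
   which every subset is measurable; see measurable_nat2 for S = nat * nat. *)
Definition tv_dist (R : realType) (d : measure_display) (S : measurableType d)
    (p q : probability S R) : \bar R :=
  ereal_sup [set (p A - q A)%E | A in [set: set S]].

Lemma measurable_nat2 (A : set (nat * nat)) : measurable A.
Proof.
apply: countable_measurable; last exact: countableP.
move=> [m n]; rewrite (_ : [set (m, n)] = [set m] `*` [set n]).
  exact: measurableX.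
by apply/seteqP; split=> [[? ?] [-> ->]|[? ?] /= [-> ->]].
Qed.

(* The second argument of the library's poisson_prob is not used.  For rate 0
   poisson_prob is the Dirac mass at 0. *)
Definition poisson (R : realType) (rate : R) : probability nat R :=
  poisson_prob rate 0.

Definition multinomial (R : realType) (L N : nat) (x : L.-tuple nat) : R :=
  N`!%:R / (\prod_(k < L) (tnth x k)`!)%N%:R.

Definition maxwell_boltzmann_pmf (R : realType) (L N : nat)
    (x : L.-tuple nat) : R :=
  if (\sum_(k < L) tnth x k == N)%N then multinomial R N x / L%:R ^+ N else 0.

Definition maxwell_boltzmann (R : realType) (d : measure_display)
    (Omega : measurableType d) (P : probability Omega R) (L N : nat)
    (X : {RV P >-> L.-tuple nat}) : Prop :=
  forall x : L.-tuple nat,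
    P [set w | X w = x] = (maxwell_boltzmann_pmf R N x)%:E.

Section coord_pair.
Context (R : realType) (d : measure_display) (Omega : measurableType d).
Context (P : probability Omega R) (L : nat) (X : {RV P >-> L.-tuple nat}).
Context (i j : 'I_L).

Definition coord_pair (w : Omega) : nat * nat := (tnth (X w) i, tnth (X w) j).

Lemma measurable_coord_pair : measurable_fun setT coord_pair.
Proof.
apply: measurable_fun_pair;
  exact: (measurableT_comp (measurable_tnth _) (@measurable_funPT _ _ _ _ X)).
Qed.

HB.instance Definition _ :=
  isMeasurableFun.Build _ _ _ _ coord_pair measurable_coord_pair.

End coord_pair.

(* Main.v *)
Require Import Defs.
From mathcomp Require Import all_boot all_order all_algebra.
From mathcomp Require Import all_classical all_reals all_analysis.
From mathcomp Require Import ring lra.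

Set Implicit Arguments.
Unset Strict Implicit.
Unset Printing Implicit Defensive.

Import Order.TTheory GRing.Theory Num.Theory.
Local Open Scope classical_set_scope.
Local Open Scope ring_scope.

(** Each of the N particles falls on the first two sites with probability
    p = 2 / L, and then on either of them with equal chance. So X_1 + X_2 is
    binomial with parameters N and p and, given the sum, X_1 arises by a fair
    splitting of it ([maxwell_boltzmann_pair_mass]). Two independent Poisson
    variables of rate N / L are likewise a fair splitting of a Poisson variable of
    rate N p ([poisson_pair_mass]). The common splitting kernel does not
    increase the total variation distance, which is therefore at most the distance
    between the binomial law and the Poisson law of rate N p, and Le Cam's bound
    for that is N p ^ 2 = 4 N / L ^ 2 ([binomial_poisson_test]).

    Only finite sums are needed. The first law lives on the triangle
    a + b <= N, and in the difference of the masses of a set A the part of A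
    outside this triangle can only lower it. Inside it, the splitting turns the
    indicator of A into the function sending k to the conditional probability that
    the pair lies in A given that its sum is k; this function has values in
    [0, 1], and Le Cam's inequality is proved for such test functions. That proof is
    an induction on the number of trials that compares Pascal's rule
    ([binomial_mass_rec]) with a lower bound for the Poisson masses
    ([poisson_mass_rec]). *)

(** * Measures on countable sets *)

(** A countable set is the union of its traces on the level sets of an injection
    into the naturals, and each trace is a point or empty. *)
Lemma null_countable (R : realType) (d : measure_display)
    (T : measurableType d) (mu : {measure set T -> \bar R}) (C : set T) :
  (forall x : T, measurable [set x]) -> countable C ->
  (forall x, C x -> mu [set x] = 0%E) -> mu C = 0%E.
Proof.
move=> m1 cC C0; have /countable_injP[f finj] := cC.
apply/eqP; rewrite -measure_le0.
have -> : C = \bigcup_n (C `&` f @^-1` [set n]).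
  by apply/seteqP; split=> [x Cx|x [n _ []]] //; exists (f x).
have mF n : measurable (C `&` f @^-1` [set n]).
  apply: countable_measurable => //.
  exact: sub_countable (subset_card_le (@subIsetl _ _ _)) cC.
apply: (le_trans (measure_sigma_subadditive mu mF (bigcup_measurable _)
  (@subset_refl _ _))) => //.
rewrite eseries0 // => n _ _.
have [->|/set0P[x [Cx fx]]] := eqVneq (C `&` f @^-1` [set n]) set0.
  by rewrite measure0.
rewrite (_ : _ `&` _ = [set x]) ?C0 //; apply/seteqP; split=> [y [Cy fy]|y ->//].
by apply: finj; rewrite ?inE //= fy fx.
Qed.

(** Used in both directions: dropping the last term bounds a measure from below
    by its masses on a finite set, and when the last term is null a countable
    law is computed by a finite sum. *)
Lemma measure_points (R : realType) (d : measure_display)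
    (T : measurableType d) (mu : {measure set T -> \bar R}) (C : set T)
    (s : seq T) :
  (forall x : T, measurable [set x]) -> measurable C -> uniq s ->
  mu C = (\sum_(x <- s | x \in C) mu [set x] + mu (C `\` [set` s]))%E.
Proof.
move=> m1 mC.
elim: s => [|x s IH] /=; first by rewrite big_nil add0e set_nil setD0.
move=> /andP[xs us]; rewrite IH // big_cons.
have -> : mu (C `\` [set` s]) =
    (mu ((C `\` [set` s]) `\` [set x]) + mu ((C `\` [set` s]) `&` [set x]))%E.
  apply: measureDI => //; apply: measurableD => //.
  exact: countable_measurable (finite_set_countable (finite_seq s)).
have -> : C `\` [set` x :: s] = (C `\` [set` s]) `\` [set x].
  apply/seteqP; split=> y /=; rewrite inE.
    by case=> Cy /negP; rewrite negb_or => /andP[/eqP yx /negP ys].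
  case=> -[Cy ys] yx; split=> //; apply/negP/norP.
  by split; [apply/eqP|apply/negP].
case: ifPn => [/set_mem Cx|/negP nCx].
  rewrite (_ : _ `&` [set x] = [set x]); last first.
    by apply/seteqP; split=> y [] // ->; split=> //; split=> //; apply/negP.
  by rewrite (addeC (mu (_ `\` _))) addeA (addeC (mu [set x])).
rewrite (_ : _ `&` [set x] = set0) ?measure0 ?adde0 //.
apply/seteqP; split=> y // [[Cy _] yx].
by apply: nCx; rewrite -yx; apply/mem_set.
Qed.

Lemma measurable_tuple_set (L : nat) (C : set (L.-tuple nat)) : measurable C.
Proof.
apply: countable_measurable; last exact: countableP.
move=> x; rewrite -(setCK [set x]); apply: measurableC.
rewrite (_ : ~` _ = \bigcup_k ((@tnth L nat)^~ k @^-1` [set~ tnth x k])).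
  apply: countable_bigcupT_measurable => [|k]; first exact: countableP.
  rewrite -[X in measurable X]setTI.
  exact: (measurable_tnth k).
apply/seteqP; split=> y /=.
  move=> yx; apply: contrapT => h; apply: yx; apply/eq_from_tnth => k.
  by apply: contrapT => yk; apply: h; exists k.
by move=> [k _ /= yk] yx; apply: yk; rewrite yx.
Qed.

(** * Le Cam's comparison of binomial and Poisson masses *)

(** With the convention 0 ^+ 0 = 1 this is also correct at rate 0, where the law
    is the Dirac mass at 0. *)
Definition poisson_mass (R : realType) (rate : R) (k : nat) : R :=
  rate ^+ k / k`!%:R * expR (- rate).

Lemma poisson_singleton (R : realType) (rate : R) (k : nat) :
  0 <= rate -> poisson rate [set k] = (poisson_mass rate k)%:E.
Proof.
rewrite le_eqVlt => /predU1P[<-|rate0]; rewrite /poisson /= /poisson_prob.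
  rewrite ltxx diracE /poisson_mass oppr0 expR0 mulr1.
  have -> : (0%N \in [set k]) = (k == 0)%N.
    by apply/idP/eqP => [/set_mem /= ->|->] //; apply/mem_set.
  by case: k => [|k]; rewrite ?expr0 ?fact0 ?divr1 // expr0n /= mul0r.
rewrite rate0 esum_set1 /poisson_pmf ?rate0 //.
by rewrite lee_fin !mulr_ge0 ?expR_ge0 ?invr_ge0 ?exprn_ge0 // ltW.
Qed.

Lemma poisson_mass_ge0 (R : realType) (rate : R) (k : nat) :
  0 <= rate -> 0 <= poisson_mass rate k.
Proof.
by move=> r0; rewrite !mulr_ge0 ?expR_ge0 ?invr_ge0 ?exprn_ge0.
Qed.

Definition binomial_mass (R : realType) (n : nat) (p : R) (k : nat) : R :=
  'C(n, k)%:R * p ^+ k * (1 - p) ^+ (n - k).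

(** Pascal's rule: condition on the outcome of the last trial. *)
Lemma binomial_mass_rec (R : realType) (n : nat) (p : R) (k : nat) :
  binomial_mass n.+1 p k.+1 =
  (1 - p) * binomial_mass n p k.+1 + p * binomial_mass n p k.
Proof.
rewrite /binomial_mass binS natrD subSS.
have [nk|kn] := leqP n k.
  by rewrite bin_small ?ltnS // exprS; ring.
by rewrite -(subnSK kn) !exprS; ring.
Qed.

Lemma binomial_mass_rec0 (R : realType) (n : nat) (p : R) :
  binomial_mass n.+1 p 0 = (1 - p) * binomial_mass n p 0.
Proof. by rewrite /binomial_mass !bin0 !subn0 exprS; ring. Qed.

(** Bernoulli's inequality (1 + 1/n)^k >= 1 + k/n, cleared of denominators so
    that it also covers n = 0. *)
Lemma bernoulli_exprn (R : realType) (n k : nat) :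
  (n%:R ^+ k.+1 + k.+1%:R * n%:R ^+ k : R) <= n.+1%:R ^+ k.+1.
Proof.
elim: k => [|k IH]; first by rewrite !expr1 expr0 -natr1; lra.
have h : (0 : R) <= n%:R ^+ k by rewrite exprn_ge0.
rewrite [leRHS]exprS (le_trans _ (ler_wpM2l _ IH)) //.
rewrite -!(natr1 n) -(natr1 k.+1) !exprS.
have k0 : (0 : R) <= k.+1%:R by [].
have := mulr_ge0 k0 h; move: (n%:R ^+ k : R) (n%:R : R) (k.+1%:R : R).
by move=> u v w huw; nra.
Qed.

(** A Poisson variable of rate (n + 1) p is a sum of independent Poisson variables
    of rates n p and p. Keeping only the values 0 and 1 of the second one gives a
    lower bound of the same shape as Pascal's rule, up to the factor
    expR (- p) >= 1 - p. The bound reduces to Bernoulli's inequality, so no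
    convolution is needed. *)
Lemma poisson_mass_rec (R : realType) (n : nat) (p : R) (k : nat) :
  0 <= p <= 1 ->
  (1 - p) * (poisson_mass (n%:R * p) k.+1 + p * poisson_mass (n%:R * p) k)
  <= poisson_mass (n.+1%:R * p) k.+1.
Proof.
move=> /andP[p0 p1].
have e : expR (- (n.+1%:R * p)) = expR (- (n%:R * p)) * expR (- p).
  by rewrite -expRD -natr1; congr expR; ring.
have -> : poisson_mass (n.+1%:R * p) k.+1 =
  expR (- p) *
    (n.+1%:R ^+ k.+1 * (p ^+ k.+1 / k.+1`!%:R * expR (- (n%:R * p)))).
  by rewrite /poisson_mass e exprMn; ring.
have -> : poisson_mass (n%:R * p) k.+1 + p * poisson_mass (n%:R * p) k =
  (n%:R ^+ k.+1 + k.+1%:R * n%:R ^+ k) *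
    (p ^+ k.+1 / k.+1`!%:R * expR (- (n%:R * p))).
  have f0 : k`!%:R != 0 :> R by rewrite pnatr_eq0 -lt0n fact_gt0.
  have k0 : k.+1%:R != 0 :> R by rewrite pnatr_eq0.
  rewrite /poisson_mass !exprMn factS natrM !exprS.
  move: (k.+1%:R : R) (k`!%:R : R) k0 f0 => u v u0 v0.
  move: (expR (- (n%:R * p))) (n%:R ^+ k : R) (p ^+ k : R) (n%:R : R).
  move=> a b c e'.
  field.
  by rewrite u0 v0.
have w0 : 0 <= p ^+ k.+1 / k.+1`!%:R * expR (- (n%:R * p)).
  by rewrite !mulr_ge0 ?expR_ge0 ?invr_ge0 ?exprn_ge0.
apply: ler_pM; first by rewrite subr_ge0.
- by rewrite mulr_ge0 // addr_ge0 ?mulr_ge0 ?exprn_ge0.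
- exact: expR_ge1Dx.
- by rewrite ler_wpM2r // bernoulli_exprn.
Qed.

Lemma poisson_mass_rec0 (R : realType) (n : nat) (p : R) :
  (1 - p) * poisson_mass (n%:R * p) 0 <= poisson_mass (n.+1%:R * p) 0.
Proof.
rewrite /poisson_mass !expr0 fact0 !divr1 !mul1r -natr1 [(_ + 1) * p]mulrDl mul1r.
by rewrite opprD expRD mulrC ler_wpM2l ?expR_ge0 // expR_ge1Dx.
Qed.

Lemma poisson_mass_sum_le1 (R : realType) (rate : R) (M : nat) :
  0 <= rate -> \sum_(k < M) poisson_mass rate k <= 1.
Proof.
move=> r0; rewrite -lee_fin -sumEFin -(probability_setT (poisson rate)).
rewrite (measure_points (poisson rate) (s := iota 0 M)) ?iota_uniq //.
rewrite -(big_mkord xpredT (fun k => (poisson_mass rate k)%:E)) /index_iota subn0.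
rewrite -[leLHS]adde0 leeD //.
rewrite [leRHS](eq_bigl xpredT) => [|x]; last by rewrite in_setT.
rewrite [leRHS](eq_bigr (fun k => (poisson_mass rate k)%:E)) // => k _.
exact: poisson_singleton.
Qed.

(** Le Cam's inequality, tested against functions with values in [0, 1]. With each
    new trial the error bound c becomes (1 - p) c + p c = c, because Pascal's rule
    and the lower bound for the Poisson masses have the same shape; the only
    discrepancy is the coefficient p of Pascal's rule against p (1 - p), which adds
    p ^ 2 times a Poisson mass, hence at most p ^ 2 in total. *)
Lemma binomial_poisson_test (R : realType) (n : nat) (p : R) (f : nat -> R)
    (M : nat) :
  0 <= p <= 1 -> (forall k, 0 <= f k <= 1) ->
  \sum_(k < M) f k * (binomial_mass n p k - poisson_mass (n%:R * p) k)
    <= n%:R * p ^+ 2.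
Proof.
move=> p01; have /andP[p0 p1] := p01.
elim: n f M => [|n IH] f M f01.
  rewrite mulr0n [leRHS]mul0r big1 // => -[k _] _ /=.
  rewrite mul0r /poisson_mass oppr0 expR0 /binomial_mass sub0n expr0 !mulr1.
  case: k => [|k]; last by rewrite bin0n expr0n /= !mul0r subrr mulr0.
  by rewrite bin0 !expr0 fact0 divr1 mulr1 subrr mulr0.
case: M => [|M]; first by rewrite big_ord0 mulr_ge0 ?exprn_ge0.
pose D k := binomial_mass n p k - poisson_mass (n%:R * p) k.
have f0 k : 0 <= f k by case/andP: (f01 k).
have f1 k : f k <= 1 by case/andP: (f01 k).
apply: (@le_trans _ _ ((1 - p) * (\sum_(k < M.+1) f k * D k) +
   (p * (\sum_(k < M) f k.+1 * D k) +
   p ^+ 2 * \sum_(k < M) poisson_mass (n%:R * p) k))); last first.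
  have h1 := IH f M.+1 f01.
  have h2 := IH (fun k => f k.+1) M (fun k => f01 k.+1).
  have h3 : \sum_(k < M) poisson_mass (n%:R * p) k <= 1.
    by rewrite poisson_mass_sum_le1 ?mulr_ge0.
  have p1' : 0 <= 1 - p by rewrite subr_ge0.
  have := ler_wpM2l p1' h1; have := ler_wpM2l p0 h2.
  have := ler_wpM2l (exprn_ge0 2 p0) h3.
  rewrite /D -natr1 => ? ? ?; lra.
rewrite !big_ord_recl [(1 - p) * (_ + _)]mulrDr !mulr_sumr -addrA -!big_split /=.
apply: lerD.
  rewrite [leRHS]mulrCA ler_wpM2l // mulrBr binomial_mass_rec0 lerD2l lerN2.
  exact: poisson_mass_rec0.
apply: ler_sum => i _; rewrite /bump /= add1n.
rewrite binomial_mass_rec.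
have := poisson_mass_rec n i p01.
have := poisson_mass_ge0 i (mulr_ge0 (ler0n _ n) p0); rewrite /D.
move: (poisson_mass _ _) (poisson_mass _ _) (poisson_mass _ _) => a b c.
move=> c0 h; have := ler_wpM2l (f0 i.+1) h.
have := ler_wpM2r (mulr_ge0 (exprn_ge0 2 p0) c0) (f1 i.+1).
move: (f i.+1) (binomial_mass n p i.+1) (binomial_mass n p i) => u v w.
by move=> ? ?; lra.
Qed.

(** * Sums over occupation vectors *)

Definition truncated_exp (R : realType) (M : nat) : {poly R} :=
  \poly_(v < M.+1) (v`!%:R)^-1.

Lemma fact_neq0 (R : realType) (n : nat) : n`!%:R != 0 :> R.
Proof. by rewrite pnatr_eq0 -lt0n fact_gt0. Qed.

(** Below the truncation order, the r-th power of exp X is exp (r X). *)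
Lemma coef_truncated_exp_pow (R : realType) (M r m : nat) :
  (m <= M)%N -> (truncated_exp R M ^+ r)`_m = r%:R ^+ m / m`!%:R.
Proof.
elim: r m => [|r IH] m mM.
  by case: m {mM} => [|m]; rewrite expr0 coef1 ?expr0 ?fact0 ?divr1 // expr0n mul0r.
rewrite exprSr coefM -[r.+1%:R]nat1r exprDn mulr_suml.
apply: eq_bigr => -[j /= jm] _; rewrite ltnS in jm.
rewrite IH ?(leq_trans jm) // coef_poly ltnS (leq_trans (leq_subr _ _)) //.
rewrite expr1n mul1r -(bin_fact jm) !natrM -[_ *+ 'C(m, j)]mulr_natr.
have := fact_neq0 R j; have := fact_neq0 R (m - j).
have : 'C(m, j)%:R != 0 :> R by rewrite pnatr_eq0 -lt0n bin_gt0.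
move: (_`!%:R : R) (_`!%:R : R) ('C(m, j)%:R : R) (_ ^+ j : R) => x y z t z0 y0 x0.
by field; rewrite x0 y0 z0.
Qed.

(** The left-hand side is the coefficient of X^N in the product over the sites of
    X^a / a!, X^b / b!, and, for the remaining L - 2 sites, the exponential series
    truncated at M. *)
Lemma sum_occupations (R : realType) (L M N a b : nat) (i j : 'I_L) :
  i != j -> (a <= M)%N -> (b <= M)%N -> (N <= M)%N ->
  \sum_(f : {ffun 'I_L -> 'I_M.+1}
         | [&& f i == a :> nat, f j == b :> nat & (\sum_k (f k : nat) == N)%N])
     \prod_k (((f k)`!)%:R)^-1 =
  (if (a + b <= N)%N then
     (L - 2)%:R ^+ (N - (a + b)) / (a`!%:R * b`!%:R * (N - (a + b))`!%:R)
   else 0 : R).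
Proof.
move=> ij aM bM NM.
(* The constraint Q forces the values at i and j and is void elsewhere. *)
pose Q (k : 'I_L) (v : 'I_M.+1) :=
  ((k == i) ==> (v == a :> nat)) && ((k == j) ==> (v == b :> nat)).
pose F (_ : 'I_L) (v : 'I_M.+1) : {poly R} := ((v`!)%:R)^-1%:P * 'X^v.
have : (\prod_k \sum_(v | Q k v) F k v)`_N =
    (\sum_(f in family Q) \prod_k F k (f k))`_N by rewrite bigA_distr_big_dep.
have Fsum (v : 'I_M.+1) (k : 'I_L) : (forall w, Q k w = (w == v)) ->
    \sum_(w | Q k w) F k w = ((v`!)%:R)^-1%:P * 'X^v.
  by move=> h; rewrite (eq_bigl _ _ h) big_pred1_eq.
rewrite (bigD1 i) //= (bigD1 j) /=; last by rewrite eq_sym.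
rewrite (Fsum (inord a)) => [|w]; last first.
  by rewrite /Q eqxx (negPf ij) andbT -val_eqE /= inordK.
rewrite (Fsum (inord b)) => [|w]; last first.
  by rewrite /Q eqxx [j == i]eq_sym (negPf ij) /= -val_eqE /= inordK.
rewrite !inordK //.
rewrite (eq_bigr (fun=> truncated_exp R M)) => [|k /andP[ki kj]]; last first.
  rewrite /Q (negPf ki) (negPf kj) /truncated_exp poly_def.
  by apply: eq_bigr => v _; rewrite /F mul_polyC.
rewrite (eq_bigl [in [predD1 [predD1 'I_L & i] & j]]) => [|k]; last first.
  by rewrite !inE andbT andbC.
rewrite prodr_const (_ : #|_| = (L - 2)%N); last first.
  have := cardD1 i 'I_L; have := cardD1 j [predD1 'I_L & i].
  rewrite card_ord !inE eq_sym ij => -> eL.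
  by rewrite [X in (X - _)%N]eL addnA addKn.
rewrite coef_sum => e.
transitivity (\sum_(f in family Q) (\prod_k F k (f k))`_N); last first.
  rewrite -e -!mulrA coefCM (mulrCA 'X^a) coefCM (mulrA 'X^a) -exprD.
  rewrite coefXnM; case: leqP => h; last by rewrite !mulr0.
  rewrite coef_truncated_exp_pow ?(leq_trans (leq_subr _ _)) //.
  by rewrite !invfM; ring.
rewrite [RHS](eq_bigr (fun f : {ffun 'I_L -> 'I_M.+1} =>
   if (\sum_k (f k : nat) == N)%N then \prod_k ((f k)`!%:R)^-1 else 0)); last first.
  move=> f _; rewrite /F big_split /= -rmorph_prod prodrXr coefCM coefXn eq_sym.
  by case: ifP; rewrite ?mulr1 ?mulr0.
rewrite -big_mkcondr; apply: eq_bigl => f; rewrite andbA; congr (_ && _).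
apply/andP/familyP => [[fi fj] k|fQ].
  by apply/andP; split; apply/implyP => /eqP ->.
have /andP[+ _] : Q i (f i) := fQ i; have /andP[_ +] : Q j (f j) := fQ j.
by rewrite !eqxx.
Qed.

(** * Fair splittings *)

(** The probability that a + b fair coin tosses give a heads and b tails. *)
Definition even_split (R : realType) (a b : nat) : R :=
  'C(a + b, a)%:R / 2 ^+ (a + b).

Lemma even_split_ge0 (R : realType) (a b : nat) : 0 <= even_split R a b.
Proof. by rewrite /even_split divr_ge0 // exprn_ge0. Qed.

Lemma even_split_sum (R : realType) (k : nat) :
  \sum_(a < k.+1) even_split R a (k - a) = 1.
Proof.
have e2 : (2 : R) ^+ k != 0 by rewrite expf_neq0 // pnatr_eq0.
apply: (mulIf e2); rewrite mul1r mulr_suml [RHS](_ : _ = (1 + 1) ^+ k) //.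
rewrite [RHS]exprDn; apply: eq_bigr => -[a /=]; rewrite ltnS => ak _.
by rewrite /even_split subnKC // divfK // !expr1n mulr1.
Qed.

Lemma even_splitE (R : realType) (a b : nat) :
  even_split R a b = (a + b)`!%:R / (a`!%:R * b`!%:R * 2 ^+ (a + b)).
Proof.
have e2 : (2 : R) ^+ (a + b) != 0 by rewrite expf_neq0 // pnatr_eq0.
have := bin_fact (leq_addr b a); rewrite addKn /even_split => <-.
rewrite !natrM; have := fact_neq0 R a; have := fact_neq0 R b.
move: (2 ^+ _ : R) e2 (a`!%:R : R) (b`!%:R : R) => u u0 v w v0 w0.
by field; rewrite u0 v0 w0.
Qed.

(** Two independent Poisson variables of equal rate are a fair splitting of
    their sum. *)
Lemma poisson_pair_mass (R : realType) (r : R) (a b : nat) :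
  poisson_mass r a * poisson_mass r b =
  even_split R a b * poisson_mass (2 * r) (a + b).
Proof.
rewrite even_splitE /poisson_mass exprMn.
rewrite (_ : - (2 * r) = - r + - r); last by ring.
rewrite expRD [r ^+ (a + b)]exprD.
have e2 : (2 : R) ^+ (a + b) != 0 by rewrite expf_neq0 // pnatr_eq0.
move: (fact_neq0 R a) (fact_neq0 R b) (fact_neq0 R (a + b)) e2.
move: (a`!%:R : R) (b`!%:R : R) ((a + b)`!%:R : R) (2 ^+ (a + b) : R) (r ^+ a) (r ^+ b).
move=> u v w x y z u0 v0 w0 x0.
by field; rewrite u0 v0 w0 x0.
Qed.

(** * The law of two occupation numbers *)

(** Each particle falls on one of the two sites with probability 2 / L, and then
    on either with equal chance. On the level of masses, the fibre of the pair over
    (a, b) carries finitely many occupation vectors of positive mass, and their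
    masses add up by the generating-function identity above. *)
Lemma maxwell_boltzmann_pair_mass (R : realType) (d : measure_display)
    (Omega : measurableType d) (P : probability Omega R) (L N : nat)
    (X : {RV P >-> L.-tuple nat}) (i j : 'I_L) (a b : nat) :
  maxwell_boltzmann N X -> i != j ->
  distribution P (coord_pair X i j) [set (a, b)] =
  (even_split R a b * binomial_mass N (2 / L%:R) (a + b))%:E.
Proof.
move=> hX ij.
(* M bounds the occupation numbers of every vector of positive mass, and also a
   and b, so that a and b need not be compared with N beforehand. *)
pose M := (N + (a + b))%N.
pose C : set (L.-tuple nat) := [set x | tnth x i = a /\ tnth x j = b].
have -> : distribution P (coord_pair X i j) [set (a, b)] = distribution P X C.
  congr (P _); apply/seteqP; split=> w.
    by case=> wi wj; split.
  by case=> /= <- <-.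
pose g (f : {ffun 'I_L -> 'I_M.+1}) : L.-tuple nat := [tuple (f k : nat) | k < L].
have ginj : injective g.
  move=> f1 f2 /(congr1 (fun x k => tnth x k)) e; apply/ffunP => k; apply: val_inj.
  by have := congr1 (@^~ k) e; rewrite /= !tnth_mktuple.
pose s := [seq g f | f <- enum {ffun 'I_L -> 'I_M.+1}].
have mass (x : L.-tuple nat) :
    distribution P X [set x] = (maxwell_boltzmann_pmf R N x)%:E.
  exact: hX.
rewrite (measure_points (distribution P X) (s := s)); last first.
- by rewrite map_inj_uniq // enum_uniq.
- exact: measurable_tuple_set.
- by move=> x; exact: measurable_tuple_set.
(* A vector outside s has an entry above M >= N, so its entries do not add up
   to N. *)
rewrite (@null_countable _ _ _ _ (C `\` _)); last first.
- move=> x [_ xs]; rewrite [LHS]mass /maxwell_boltzmann_pmf.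
  case: eqP => // xN; exfalso; apply: xs.
  have xM k : (tnth x k < M.+1)%N.
    by rewrite ltnS /M -xN (bigD1 k) //= -addnA leq_addr.
  apply/mapP; exists [ffun k => inord (tnth x k)]; first by rewrite mem_enum.
  by apply: eq_from_tnth => k; rewrite tnth_mktuple ffunE inordK.
- exact: countableP.
- by move=> x; exact: measurable_tuple_set.
rewrite adde0 big_map big_enum_cond /=.
rewrite (eq_bigl (fun f : {ffun 'I_L -> 'I_M.+1} =>
    (f i == a :> nat) && (f j == b :> nat))); last first.
  move=> f; rewrite /C; apply/idP/andP.
    by move=> /set_mem; rewrite /= !tnth_mktuple => -[-> ->].
  by move=> [/eqP fi /eqP fj]; apply/mem_set; rewrite /= !tnth_mktuple.
rewrite (eq_bigr (fun f => (maxwell_boltzmann_pmf R N (g f))%:E)); last first.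
  by move=> f _; exact: mass.
rewrite sumEFin; congr EFin.
transitivity (N`!%:R / L%:R ^+ N * \sum_(f : {ffun 'I_L -> 'I_M.+1}
    | [&& f i == a :> nat, f j == b :> nat & (\sum_k (f k : nat) == N)%N])
   \prod_k (((f k)`!)%:R)^-1 : R).
  rewrite mulr_sumr [RHS](eq_bigl (fun f : {ffun 'I_L -> 'I_M.+1} =>
     ((f i == a :> nat) && (f j == b :> nat)) && (\sum_k (f k : nat) == N)%N)).
    rewrite [RHS]big_mkcondr; apply: eq_bigr => f _.
    rewrite /maxwell_boltzmann_pmf /multinomial.
    rewrite (eq_bigr (fun k => f k : nat)) => [|k _]; last by rewrite tnth_mktuple.
    case: ifP => // _; rewrite (eq_bigr (fun k => (f k)`!)) => [|k _]; last first.
      by rewrite tnth_mktuple.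
    by rewrite natr_prod prodfV mulrAC.
  by move=> f; rewrite andbA.
rewrite sum_occupations //; first last.
- by rewrite /M leq_addr.
- by rewrite /M addnA leq_addl.
- by rewrite /M addnCA leq_addr.
have L2 : (2 <= L)%N.
  by case: L i j ij {C g ginj s mass X hX} => [[]|[|//]] // [[|?] ?] [[|?] ?].
have L0 : L%:R != 0 :> R by rewrite pnatr_eq0 -lt0n (leq_trans _ L2).
rewrite even_splitE; case: leqP => abN; last first.
  by rewrite /binomial_mass bin_small // !mul0r !mulr0.
move: (a + b)%N abN => k kN; rewrite /binomial_mass.
rewrite (_ : 1 - 2 / L%:R = (L - 2)%:R / L%:R); last first.
  by rewrite natrB // mulrBl divff.
rewrite !expr_div_n -{1 2}(subnKC kN) exprD subnKC //.
rewrite -(bin_fact kN) !natrM.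
have e2 : (2 : R) ^+ k != 0 by rewrite expf_neq0 // pnatr_eq0.
move: (fact_neq0 R a) (fact_neq0 R b) (fact_neq0 R (N - k)) e2.
move: (expf_neq0 k L0) (expf_neq0 (N - k) L0).
move: (a`!%:R : R) (b`!%:R : R) ((N - k)`!%:R : R) (2 ^+ k : R).
move: (L%:R ^+ k : R) (L%:R ^+ (N - k) : R) ((L - 2)%:R ^+ (N - k) : R).
move=> t1 t2 t3 u v w x t10 t20 u0 v0 w0 x0.
by field; rewrite t10 t20 u0 v0 w0 x0.
Qed.

Theorem theorem3p3 (R : realType) (d : measure_display)
    (Omega : measurableType d) (P : probability Omega R)
    (L N : nat) (hL : (2 <= L)%N) (X : {RV P >-> L.-tuple nat})
    (hX : maxwell_boltzmann N X) :
  (tv_dist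
     (distribution P (coord_pair X (Ordinal (ltnW hL)) (Ordinal hL)))
     (poisson (N%:R / L%:R : R) \x poisson (N%:R / L%:R : R))
   <= (4 * N%:R / L%:R ^+ 2)%:E)%E.
Proof.
set gamma := distribution P _; set r : R := N%:R / L%:R.
have L0 : (0 : R) < L%:R by rewrite ltr0n (leq_trans _ hL).
have r0 : 0 <= r by rewrite divr_ge0.
pose p : R := 2 / L%:R.
have p01 : 0 <= p <= 1.
  by rewrite divr_ge0 // ler_pdivrMr // mul1r ler_nat.
have pr : N%:R * p = 2 * r by rewrite /p /r; ring.
have m1 (x : nat * nat) : measurable [set x] by exact: measurable_nat2.
have gammaE (x : nat * nat) : gamma [set x] =
    (even_split R x.1 x.2 * binomial_mass N p (x.1 + x.2))%:E.
  by case: x => a b; exact: maxwell_boltzmann_pair_mass.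
have piE (x : nat * nat) : (poisson r \x poisson r)%E [set x] =
    (even_split R x.1 x.2 * poisson_mass (2 * r) (x.1 + x.2))%:E.
  case: x => a b; rewrite (_ : [set _] = [set a] `*` [set b]); last first.
    by apply/seteqP; split=> -[? ?] /= [-> ->].
  rewrite product_measure1E //= -poisson_pair_mass.
  by rewrite -[poisson_prob _ _ [set a]]/(poisson r [set a])
     -[poisson_prob _ _ [set b]]/(poisson r [set b]) !poisson_singleton.
(* The triangle a + b <= N, listed by the value of k = a + b. *)
pose s := [seq (a, k - a)%N | k <- iota 0 N.+1, a <- iota 0 k.+1].
have us : uniq s.
  apply: allpairs_uniq_dep => [|k _|]; rewrite ?iota_uniq //.
  move=> _ _ /allpairsPdep[k [a [_ + ->]]] /allpairsPdep[k' [a' [_ + ->]]] /=.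
  rewrite !mem_iota /= !add0n !ltnS => ak ak' [aa' kk'].
  by subst a'; have <- : k = k' by rewrite -(subnKC ak) kk' subnKC.
apply: ge_ereal_sup => _ [A _ <-].
rewrite (measure_points gamma (s := s)) //; last exact: measurable_nat2.
rewrite (@null_countable _ _ _ _ (A `\` _)) //; last first.
- move=> [a b] [_ /negP abs].
  rewrite [LHS]gammaE /binomial_mass bin_small ?mul0r ?mulr0 //.
  rewrite ltnNge; apply: contra abs => abN.
  apply/allpairsPdep; exists (a + b)%N, a.
  by rewrite !mem_iota /= !add0n !ltnS leq_addr addKn.
- exact: countableP.
rewrite adde0.
rewrite (measure_points _ (s := s) m1) //; last exact: measurable_nat2.
apply: (@le_trans _ _ (\sum_(x <- s | x \in A) gamma [set x] -
    \sum_(x <- s | x \in A) (poisson r \x poisson r) [set x])%E).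
  by apply: leeB => //; rewrite leeDl.
rewrite (eq_bigr _ (fun x _ => gammaE x)) (eq_bigr _ (fun x _ => piE x)).
rewrite !sumEFin -EFinB lee_fin -sumrB.
rewrite [leRHS](_ : _ = N%:R * p ^+ 2); last first.
  by rewrite /p expr_div_n; ring.
(* f k is the probability, given the sum k, that the pair lies in A. *)
pose f k := \sum_(a < k.+1 | (a : nat, (k - a)%N) \in A)
    even_split R a (k - a).
have f01 k : 0 <= f k <= 1.
  rewrite sumr_ge0 /= => [|a _]; last exact: even_split_ge0.
  rewrite -(even_split_sum R k) /f big_mkcond ler_sum // => a _.
  by case: ifP => // _; exact: even_split_ge0.
apply: le_trans (binomial_poisson_test N N.+1 p01 f01).
rewrite big_mkcond big_allpairs_dep le_eqVlt; apply/orP; left; apply/eqP.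
rewrite -[iota 0 N.+1]/(index_iota 0 N.+1) big_mkord; apply: eq_bigr => k _.
rewrite -[iota 0 k.+1]/(index_iota 0 k.+1) big_mkord -big_mkcond /f mulr_suml.
apply: eq_bigr => -[a /=]; rewrite ltnS => ak _.
by rewrite subnKC // pr mulrBr.
Qed.
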